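(* Let $d=2$ and let $\mathcal D\subseteq\mathbb S_1^1$ be a half-open interval (arc) of arclength $\tau>\pi$. Then for any $M\in\mathrm{SL}(3,\mathbb R)$, $$\mathcal G_{\mathcal D}(M)\le\begin{cases} 9 & \text{if } 5\pi/3<\tau<2\pi,\\ 8 & \text{if } \tau=5\pi/3,\\ 9 & \text{if } 4\pi/3<\tau<5\pi/3,\\ 8&\text{if } \tau=4\pi/3,\\ 12+2\left\lfloor\frac{\sin(\tau/2+\pi/6)}{\sin(\tau-\pi)}\right\rfloor & \text{if } \pi<\tau<4\pi/3.\end{cases}$$
   Context: Elements of $\mathbb R^{d+1}$ are row vectors written $(u,\vec v)$ with $u\in\mathbb R$, $\vec v\in\mathbb R^d$; for $M\in\mathrm{SL}(d+1,\mathbb R)$, $\mathbb Z^{d+1}M$ is the lattice of row vectors $\vec m M$, $\vec m\in\mathbb Z^{d+1}$. For $\mathcal D\subseteq\mathbb S_1^{d-1}$ (unit sphere) and $t\in(0,1)$ let $\mathcal Q_{\mathcal D}(M,t)=\{(u,\vec v)\in\mathbb Z^{d+1}M : -t<u<1-t,\ \vec v\in\mathbb R_{>0}\mathcal D\}$ and $F_{\mathcal D}(M,t)=\min\{|\vec v| : (u,\vec v)\in\mathcal Q_{\mathcal D}(M,t)\}$ (Euclidean norm; this minimum exists when $\mathcal D$ has non-empty interior). $\mathcal G_{\mathcal D}(M)=|\{F_{\mathcal D}(M,t):0<t<1\}|$ is the number of distinct values of $t\mapsto F_{\mathcal D}(M,t)$. *)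

(* Defs.v *)
From HB Require Import structures.
From mathcomp Require Import all_boot all_order all_algebra.
From mathcomp Require Import all_classical all_reals all_analysis.
Set Implicit Arguments. Unset Strict Implicit. Unset Printing Implicit Defensive.
Import Order.TTheory GRing.Theory Num.Theory.
Local Open Scope ring_scope.
Local Open Scope classical_set_scope.

Section Defs.
Variable R : realType.

Definition lattice_pt (M : 'M[R]_3) (m : 'rV[int]_3) : 'rV[R]_3 :=
  map_mx intr m *m M.

Definition halfopen_arc (cl : bool) (alpha tau : R) : set (R * R) :=
  [set p | exists theta : R,
     (if cl then (alpha <= theta) && (theta < alpha + tau)
            else (alpha < theta) && (theta <= alpha + tau)) /\
     p = (cos theta, sin theta)].

Definition in_cone (D : set (R * R)) (x y : R) : Prop :=
  exists r : R, exists p : R * R, 0 < r /\ D p /\ x = r * p.1 /\ y = r * p.2.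

Definition inQ (M : 'M[R]_3) (D : set (R * R)) (t : R) (v : 'rV[R]_3) : Prop :=
  (exists m, v = lattice_pt M m) /\
  - t < v ord0 ord0 < 1 - t /\
  in_cone D (v ord0 (inord 1)) (v ord0 (inord 2)).

Definition vnorm (v : 'rV[R]_3) : R :=
  Num.sqrt (v ord0 (inord 1) ^+ 2 + v ord0 (inord 2) ^+ 2).

Definition F_is (M : 'M[R]_3) (D : set (R * R)) (t r : R) : Prop :=
  (exists v, inQ M D t v /\ vnorm v = r) /\
  (forall v, inQ M D t v -> r <= vnorm v).

Definition Fvalues (M : 'M[R]_3) (D : set (R * R)) : set R :=
  [set r | exists t : R, 0 < t < 1 /\ F_is M D t r].

Definition bound41 (tau : R) : int :=
  if 5%:R * pi / 3%:R < tau then 9%:Z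
  else if tau == 5%:R * pi / 3%:R then 8%:Z
  else if 4%:R * pi / 3%:R < tau then 9%:Z
  else if tau == 4%:R * pi / 3%:R then 8%:Z
  else 12%:Z + 2%:Z * Num.floor (sin (tau / 2%:R + pi / 6%:R) / sin (tau - pi)).

End Defs.

(* Main.v *)
Require Import Defs.
From HB Require Import structures.
From mathcomp Require Import all_boot all_order all_algebra.
From mathcomp Require Import all_classical all_reals all_analysis.
From mathcomp Require Import zify ring lra.
Import Order.TTheory GRing.Theory Num.Theory.
Local Open Scope ring_scope.
Local Open Scope classical_set_scope.

Set Implicit Arguments.
Unset Strict Implicit.

(* Let [rho] be the largest of finitely many given values, attained at [t = s];
   reversing the [u]-axis if needed, assume [s >= 1/2]. No lattice vector [(u, x)]
   with [-s < u < 1 - s] has [x] in the cone [C] and [|x| < rho]. Hence each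
   smaller value [r] is attained by a vector which, up to sign, has height [u] in
   [1 - s, 1). Applying the same emptiness to the differences of two such vectors,
   [C] containing every nonzero [x] or its opposite, shows that the planar parts
   [x], [y] are at distance at least [rho], unless [x] and [y - x] both lie in
   [B := {z | - z notin C}] and make an angle larger than [2 pi / 3]. Now [B] is a
   sector of opening [2 pi - tau]: for [tau >= 4 pi / 3] such exceptional pairs do
   not exist, and otherwise [x] is within [4 pi / 3 - tau] of an edge of [B].
   Points that are not near an edge are [rho]-separated in a disc of radius [rho],
   so there are at most 6 of them. Near a given edge all pairs are exceptional and
   the distances to this edge decrease by steps of at least [r * sin (tau - pi)],
   [r] being the least norm, from at most [r * sin (tau / 2 + pi / 6)]. *)

(** * Polar coordinates in the plane and norms of sums and differences *)

Section PlanarGeometry.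
Variable R : realType.
Implicit Types (x y : R * R) (p q r a t u : R).

Definition pnorm x : R := Num.sqrt (x.1 ^+ 2 + x.2 ^+ 2).

Definition polar r t : R * R := (r * cos t, r * sin t).

Definition cross x y : R := x.1 * y.2 - x.2 * y.1.

Lemma pnorm_ge0 x : 0 <= pnorm x.
Proof. exact: sqrtr_ge0. Qed.

Lemma sqr_pnorm x : pnorm x ^+ 2 = x.1 ^+ 2 + x.2 ^+ 2.
Proof. by rewrite sqr_sqrtr// addr_ge0 ?sqr_ge0. Qed.

Lemma pnormN x : pnorm (- x) = pnorm x.
Proof. by rewrite /pnorm /= !sqrrN. Qed.

Lemma pnormB x y : pnorm (x - y) = pnorm (y - x).
Proof. by rewrite -pnormN opprB. Qed.

Lemma pnorm_gt0 x : x != 0 -> 0 < pnorm x.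
Proof.
case: x => a b; rewrite sqrtr_gt0 /= => ab0.
rewrite lt_neqAle addr_ge0 ?sqr_ge0// andbT eq_sym paddr_eq0 ?sqr_ge0//.
by rewrite !sqrf_eq0; apply: contra ab0 => /andP[/eqP -> /eqP ->].
Qed.

Lemma pnorm_polar r t : 0 <= r -> pnorm (polar r t) = r.
Proof.
move=> r0; apply/eqP; rewrite -(@eqrXn2 _ 2)// ?pnorm_ge0// sqr_pnorm /=.
by rewrite !exprMn -mulrDr cos2Dsin2 mulr1.
Qed.

Lemma polarDpi r t : polar r (t + pi) = - polar r t.
Proof. by rewrite /polar sinDpi cosDpi !mulrN. Qed.

Lemma polarBpi r t : polar r (t - pi) = - polar r t.
Proof. by rewrite -[t in RHS](subrK pi) polarDpi opprK. Qed.

Lemma polarD2pi r t : polar r (t + 2 * pi) = polar r t.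
Proof. by rewrite mulrDl !mul1r addrA !polarDpi opprK. Qed.

Lemma crossDl x y z : cross (x + y) z = cross x z + cross y z.
Proof. rewrite /cross /=; ring. Qed.

Lemma crossDr x y z : cross x (y + z) = cross x y + cross x z.
Proof. rewrite /cross /=; ring. Qed.

Lemma cross_polar p q t u : cross (polar p t) (polar q u) = p * q * sin (u - t).
Proof. by rewrite sinB /cross /=; ring. Qed.

Lemma sqr_pnormD_polar p q t u :
  pnorm (polar p t + polar q u) ^+ 2 = p ^+ 2 + q ^+ 2 + 2 * p * q * cos (t - u).
Proof.
rewrite sqr_pnorm cosB /=.
have := cos2Dsin2 t; have := cos2Dsin2 u.
set c := cos t; set s := sin t; set c' := cos u; set s' := sin u => h' h.
have -> : p ^+ 2 = p ^+ 2 * (c ^+ 2 + s ^+ 2) by rewrite h mulr1.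
have -> : q ^+ 2 = q ^+ 2 * (c' ^+ 2 + s' ^+ 2) by rewrite h' mulr1.
ring.
Qed.

Lemma sqr_pnormB_polar p q t u :
  pnorm (polar p t - polar q u) ^+ 2 = p ^+ 2 + q ^+ 2 - 2 * p * q * cos (t - u).
Proof.
rewrite -polarDpi sqr_pnormD_polar opprD addrA -[X in _ + X](opprK) -mulrN.
by rewrite -cosDpi subrK.
Qed.

(** The base angle [a] is free so that the angle can be chosen in whichever full turn suits the cone
    at hand. *)
Lemma exists_polar x a :
  exists t : R, [/\ a <= t, t < a + 2 * pi & x = polar (pnorm x) t].
Proof.
have pi0 := pi_gt0 R.
have [->|x0] := eqVneq x 0.
  exists a; split => //; first lra.
  by rewrite /polar /pnorm /= expr0n addr0 sqrtr0 !mul0r.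
have n0 := pnorm_gt0 x0.
set n := pnorm x in n0 *.
(* [c] and [s] are the cosine and sine of the angle of [x] measured from direction [a]. *)
pose c := (x.1 * cos a + x.2 * sin a) / n.
pose s := (x.2 * cos a - x.1 * sin a) / n.
have cs : c ^+ 2 + s ^+ 2 = 1.
  rewrite /c /s !expr_div_n -mulrDl; apply: (@mulIf _ (n ^+ 2)).
    by rewrite expf_neq0// gt_eqF.
  rewrite divfK ?expf_neq0 ?gt_eqF// mul1r sqr_pnorm.
  rewrite -[RHS]mulr1 -[X in _ = _ * X](cos2Dsin2 a); ring.
have c11 : -1 <= c <= 1 by have s2 := sqr_ge0 s; apply/andP; split; nra.
have ca : cos (acos c) = c by apply: acosK; rewrite in_itv.
have sa : sin (acos c) = `|s|.
  by rewrite sin_acos// -sqrtr_sqr; congr Num.sqrt; lra.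
have key t : cos t = c -> sin t = s -> x = polar n (a + t).
  move=> ct st; rewrite /polar cosD sinD ct st /c /s.
  have nn : n != 0 by rewrite gt_eqF.
  have sc2 := cos2Dsin2 a.
  rewrite [LHS]surjective_pairing; congr pair.
    by rewrite -[LHS]mulr1 -[X in _ * X = _]sc2; field.
  by rewrite -[LHS]mulr1 -[X in _ * X = _]sc2; field.
have a0 := acos_ge0 c11; have api := acos_lepi c11.
have [s0|s0] := leP 0 s.
  by exists (a + acos c); split; [lra|lra|apply: key => //; rewrite sa ger0_norm].
(* This keeps the angle [2 * pi - acos c] strictly below a full turn. *)
have ap : 0 < acos c.
  rewrite lt_neqAle a0 andbT; apply/eqP => ac0.
  by move: sa; rewrite -ac0 sin0 ltr0_norm// => ?; lra.
exists (a + (- acos c + 2 * pi)); split; [lra|lra|].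
apply: key; rewrite mulr_natl.
  by rewrite cosD2pi cosN.
by rewrite sinD2pi sinN sa ltr0_norm// opprK.
Qed.

Lemma cos_pi3 : cos (pi / 3) = 1 / 2 :> R.
Proof.
have pi0 := pi_gt0 R.
have c0 : 0 < cos (pi / 3) :> R by apply: cos_gt0_pihalf; apply/andP; split; lra.
(* The triple angle formula at [pi / 3] gives [4 c^3 - 3 c = -1], whose only positive root is
   [1 / 2]. *)
have : cos (pi / 3 + (pi / 3) *+ 2) = -1 :> R by rewrite -cospi; congr cos; lra.
rewrite cosD cos_mulr2n sin_mulr2n.
have := cos2Dsin2 (pi / 3 : R).
set c := cos _ in c0 *; set s := sin _ => cs h.
have : (c + 1) * (2 * c - 1) ^+ 2 = 0.
  have -> : (c + 1) * (2 * c - 1) ^+ 2 = 4 * c ^+ 3 - 3 * c + 1 by ring.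
  have s2 : s ^+ 2 = 1 - c ^+ 2 by lra.
  have <- : c * (c ^+ 2 *+ 2 - 1) - s * ((c * s) *+ 2) = 4 * c ^+ 3 - 3 * c.
    have -> : s * ((c * s) *+ 2) = 2 * c * s ^+ 2 by ring.
    rewrite s2; ring.
  rewrite h; ring.
move/eqP; rewrite mulf_eq0 => /orP[/eqP ?|]; first lra.
by rewrite sqrf_eq0 => /eqP ?; lra.
Qed.

Lemma cos_gt_half t : `|t| < pi / 3 -> 1 / 2 < cos t.
Proof.
move=> tp; have pi0 := pi_gt0 R; have t0 := normr_ge0 t.
rewrite -cos_pi3 -(cos_norm t) ltr_cos// in_itv /=; apply/andP; split; lra.
Qed.

Lemma cos_ge_neghalf t : `|t| <= 2 * pi / 3 -> - (1 / 2) <= cos t.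
Proof.
move=> tp; have pi0 := pi_gt0 R; have t0 := normr_ge0 t.
have -> : - (1 / 2) = cos (2 * pi / 3) :> R.
  have -> : 2 * pi / 3 = pi - pi / 3 :> R by lra.
  rewrite cosB cospi sinpi cos_pi3; ring.
by rewrite -(cos_norm t) leNgt ltr_cos -?leNgt// in_itv /=; apply/andP; split; lra.
Qed.

Lemma sin_le_pihalf t u : 0 <= t -> t <= u -> u <= pi / 2 -> sin t <= sin u.
Proof.
move=> t0 tu up; have pi0 := pi_gt0 R.
by rewrite leNgt ltr_sin -?leNgt// in_itv /=; apply/andP; split; lra.
Qed.

Lemma sin_pi_sub t : sin (pi - t) = sin t.
Proof. by rewrite sinB sinpi cospi; ring. Qed.

(** The squared distance is below [p^2 + q^2 - p q], which is at most the square of the larger of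
    [p] and [q]. *)
Lemma pnormB_lt_of_angle p q t u rho : 0 < p < rho -> 0 < q < rho ->
  `|t - u| < pi / 3 -> pnorm (polar p t - polar q u) < rho.
Proof.
move=> /andP[p0 pr] /andP[q0 qr] /cos_gt_half c.
have r0 : 0 <= rho by lra.
rewrite -(@ltr_pXn2r _ 2)// ?nnegrE ?pnorm_ge0// sqr_pnormB_polar.
have pq : 0 < p * q by rewrite mulr_gt0.
have [pleq|qltp] := leP p q.
  by nra.
by nra.
Qed.

(** Otherwise [n^2 >= p^2 + q^2 - p q]. This is at least [p^2 > n^2] if [p <= q], and exceeds
    [q^2 >= n^2] if [q < p]. *)
Lemma cos_lt_of_pnormD p q t u n : 0 < p -> 0 < q ->
  pnorm (polar p t + polar q u) = n -> n < p -> n <= q -> cos (t - u) < - (1 / 2).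
Proof.
move=> p0 q0 e np nq; rewrite ltNge; apply/negP => c.
have n0 : 0 <= n by rewrite -e pnorm_ge0.
have := sqr_pnormD_polar p q t u; rewrite e => e2.
have pq : 0 < p * q by rewrite mulr_gt0.
have h : p ^+ 2 + q ^+ 2 - p * q <= n ^+ 2 by nra.
have [pleq|qltp] := leP p q; nra.
Qed.

End PlanarGeometry.

(** * The cone over a half-open arc and its complement *)

Section Cone.
Variables (R : realType) (cl : bool) (alpha tau : R).
Hypotheses (pi_lt_tau : pi < tau) (tau_lt_2pi : tau < 2 * pi).
Implicit Types (x y : R * R).

Definition cone x : Prop := in_cone (halfopen_arc cl alpha tau) x.1 x.2.

Definition halfopen_itv (a b t : R) : bool :=
  if cl then (a <= t) && (t < b) else (a < t) && (t <= b).

Lemma cone_polarP x : cone x <-> exists r t : R,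
  [/\ 0 < r, halfopen_itv alpha (alpha + tau) t & x = polar r t].
Proof.
split=> [[r [p [r0 [[t [tI ->]] /= [x1 x2]]]]]|[r [t [r0 tI ->]]]].
  by exists r, t; split=> //; rewrite [LHS]surjective_pairing x1 x2.
by exists r, (cos t, sin t); split=> //; split; first by exists t.
Qed.

Lemma cone_pnorm_gt0 x : cone x -> 0 < pnorm x.
Proof. by case/cone_polarP => r [t [r0 _ ->]]; rewrite pnorm_polar// ltW. Qed.

Lemma notcone_polar x : x != 0 -> ~ cone x ->
  exists2 t, halfopen_itv (alpha + tau) (alpha + 2 * pi) t & x = polar (pnorm x) t.
Proof.
move=> x0 nC; have n0 := pnorm_gt0 x0.
have [t [ta tb xt]] := exists_polar x alpha.
have [u uI xu] : exists2 u,
    halfopen_itv alpha (alpha + 2 * pi) u & x = polar (pnorm x) u.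
  rewrite /halfopen_itv; case: (cl); first by exists t => //; rewrite ta.
  move: ta; rewrite le_eqVlt => /orP[/eqP ta|ta]; last first.
    by exists t => //; rewrite ta ltW.
  (* When the arc omits its left end, the angle [alpha] itself is moved to the other end of the
     turn. *)
  exists (t + 2 * pi); last by rewrite polarD2pi.
  by have pi0 := pi_gt0 R; apply/andP; split; lra.
exists u => //.
have {nC} : ~~ halfopen_itv alpha (alpha + tau) u.
  by apply/negP => uC; apply: nC; apply/cone_polarP; exists (pnorm x), u.
move: uI; rewrite /halfopen_itv; case: ifP => _ /andP[-> ->] /=; rewrite andbT.
  by rewrite leNgt.
by rewrite ltNge.
Qed.

(** The complement has opening [2 * pi - tau < pi < tau], so a half turn carries it into the arc. *)
Lemma cone_or_coneN x : x != 0 -> ~ cone x -> cone (- x).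
Proof.
have tau_gt := pi_lt_tau; have tau_lt := tau_lt_2pi.
move=> x0 /(notcone_polar x0)[t tI xt]; apply/cone_polarP.
exists (pnorm x), (t - pi); split; first exact: pnorm_gt0.
  by move: tI; rewrite /halfopen_itv; case: ifP => _ /andP[? ?]; apply/andP; split; lra.
by rewrite polarBpi -xt.
Qed.

(** The angle is measured from the first edge of the sector; closing the interval at both ends
    covers both values of [cl]. *)
Lemma notconeN_polar x : x != 0 -> ~ cone (- x) ->
  exists2 t : R, 0 <= t <= 2 * pi - tau & x = polar (pnorm x) (alpha + tau - pi + t).
Proof.
have tau_gt := pi_lt_tau; have tau_lt := tau_lt_2pi.
move=> x0 /notcone_polar; rewrite oppr_eq0 => /(_ x0) [t tI xt].
exists (t - alpha - tau).
  by move: tI; rewrite /halfopen_itv; case: ifP => _ /andP[? ?]; apply/andP; split; lra.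
rewrite (_ : alpha + tau - pi + _ = t - pi); last lra.
by rewrite polarBpi -(pnormN x) -xt opprK.
Qed.

Lemma sin_lt0_Npi_0 (t : R) : - pi < t -> t < 0 -> sin t < 0.
Proof.
move=> t1 t2; have : 0 < sin (- t) by apply: sin_gt0_pi; apply/andP; split; lra.
by rewrite sinN; lra.
Qed.

(* The complement of the cone is, up to the origin, a convex sector of opening
   [2 pi - tau < pi]; the two cross products below are the signed distances to
   its bounding lines. *)
Lemma notconeD x y : ~ cone x -> ~ cone y -> ~ cone (x + y).
Proof.
have tau_gt := pi_lt_tau; have tau_lt := tau_lt_2pi.
have [->|x0] := eqVneq x 0; first by rewrite add0r.
have [->|y0] := eqVneq y 0; first by rewrite addr0.
have nx := pnorm_gt0 x0; have ny := pnorm_gt0 y0.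
move=> /(notcone_polar x0)[t tI xt] /(notcone_polar y0)[u uI yu].
move=> /cone_polarP [r [v [r0 vI xyv]]].
have pi0 := pi_gt0 R.
pose e1 := polar 1 (alpha + tau); pose e2 := polar 1 (alpha + pi).
have E1 : r * sin (v - (alpha + tau)) =
    pnorm x * sin (t - (alpha + tau)) + pnorm y * sin (u - (alpha + tau)).
  have := crossDr e1 x y; rewrite xyv xt yu !cross_polar !mul1r.
  by rewrite !pnorm_polar ?pnorm_ge0.
have E2 : r * sin (v - (alpha + pi)) =
    pnorm x * sin (t - (alpha + pi)) + pnorm y * sin (u - (alpha + pi)).
  have := crossDr e2 x y; rewrite xyv xt yu !cross_polar !mul1r.
  by rewrite !pnorm_polar ?pnorm_ge0.
move: tI uI vI; rewrite /halfopen_itv.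
(* The included end of the arc decides which of the two signed distances is strictly positive off
   the cone; an angle [v] of the arc violates one of the two inequalities. *)
case: ifP => _ /andP[t1 t2] /andP[u1 u2] /andP[v1 v2].
- have st : 0 <= sin (t - (alpha + tau)).
    by apply: sin_ge0_pi; apply/andP; split; lra.
  have su : 0 <= sin (u - (alpha + tau)).
    by apply: sin_ge0_pi; apply/andP; split; lra.
  have st' : 0 < sin (t - (alpha + pi)).
    by apply: sin_gt0_pi; apply/andP; split; lra.
  have su' : 0 < sin (u - (alpha + pi)).
    by apply: sin_gt0_pi; apply/andP; split; lra.
  have s1 : 0 <= r * sin (v - (alpha + tau)).
    by rewrite E1 addr_ge0// mulr_ge0// ltW.
  have s2 : 0 < r * sin (v - (alpha + pi)).
    by rewrite E2 addr_gt0// mulr_gt0.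
  rewrite pmulr_rge0// in s1; rewrite pmulr_rgt0// in s2.
  have [vle|vgt] := leP v (alpha + pi).
    have : 0 <= sin (v - (alpha + pi) + pi).
      by apply: sin_ge0_pi; apply/andP; split; lra.
    by rewrite sinDpi; lra.
  have : sin (v - (alpha + tau)) < 0 by apply: sin_lt0_Npi_0; lra.
  by rewrite ltNge s1.
- have st : 0 < sin (t - (alpha + tau)).
    by apply: sin_gt0_pi; apply/andP; split; lra.
  have su : 0 < sin (u - (alpha + tau)).
    by apply: sin_gt0_pi; apply/andP; split; lra.
  have st' : 0 <= sin (t - (alpha + pi)).
    by apply: sin_ge0_pi; apply/andP; split; lra.
  have su' : 0 <= sin (u - (alpha + pi)).
    by apply: sin_ge0_pi; apply/andP; split; lra.
  have s1 : 0 < r * sin (v - (alpha + tau)).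
    by rewrite E1 addr_gt0// mulr_gt0.
  have s2 : 0 <= r * sin (v - (alpha + pi)).
    by rewrite E2 addr_ge0// mulr_ge0// ltW.
  rewrite pmulr_rgt0// in s1; rewrite pmulr_rge0// in s2.
  have [vlt|vge] := ltP v (alpha + pi).
    have : sin (v - (alpha + pi)) < 0 by apply: sin_lt0_Npi_0; lra.
    by rewrite ltNge s2.
  have : sin (v - (alpha + tau)) <= 0.
    have [->|ne] := eqVneq v (alpha + tau); first by rewrite subrr sin0.
    have vlt : v < alpha + tau by rewrite lt_neqAle ne.
    by apply: ltW; apply: sin_lt0_Npi_0; lra.
  by rewrite leNgt s1.
Qed.

End Cone.

(** * Bounds on the length of duplicate-free lists of reals *)

Section Counting.
Variable R : realType.
Implicit Types (V : seq R) (r : R).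

Lemma size_le_of_inj V (f : R -> nat) n : uniq V -> {in V &, injective f} ->
  (forall r, r \in V -> (f r < n)%N) -> (size V <= n)%N.
Proof.
move=> uV fI fn; rewrite -(size_map f) -[leqRHS](size_iota 0).
apply: uniq_leq_size; first by rewrite map_inj_in_uniq.
by move=> _ /mapP[r rV ->]; rewrite mem_iota add0n fn.
Qed.

Lemma truncn_eq_lt1 (a b : R) : 0 <= a -> 0 <= b ->
  Num.truncn a = Num.truncn b -> `|a - b| < 1.
Proof.
move=> /truncn_itv/andP[a1 a2] /truncn_itv/andP[b1 b2] ab.
rewrite ab in a1 a2; rewrite -natr1 in a2 b2.
by rewrite ltr_norml; apply/andP; split; lra.
Qed.

(** Each of the six half-open sectors of opening [pi / 3] holds at most one of the points, since two
    of them there would be closer than [rho]. *)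
Lemma size_separated V (x : R -> R * R) (rho : R) : uniq V ->
  (forall r, r \in V -> pnorm (x r) = r /\ 0 < r < rho) ->
  (forall r r', r \in V -> r' \in V -> r != r' -> rho <= pnorm (x r - x r')) ->
  (size V <= 6)%N.
Proof.
move=> uV xV xsep; have pi0 := pi_gt0 R; have p3 : 0 < pi / 3 :> R by lra.
have /choice[t tP] : forall r, exists t : R,
    [/\ 0 <= t, t < 2 * pi & x r = polar (pnorm (x r)) t].
  by move=> r; have [t] := exists_polar (x r) 0; rewrite add0r; exists t.
have tge0 r : 0 <= t r / (pi / 3).
  by have [t0 _ _] := tP r; rewrite divr_ge0// ltW.
apply: (@size_le_of_inj _ (fun r => Num.truncn (t r / (pi / 3)))) => //.
  move=> r r' rV r'V /truncn_eq_lt1 -/(_ (tge0 _) (tge0 _)) h.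
  apply/eqP/negPn/negP => /(xsep _ _ rV r'V); apply/negP; rewrite -ltNge.
  have [_ _ ->] := tP r; have [_ _ ->] := tP r'.
  have [-> rr] := xV _ rV; have [-> rr'] := xV _ r'V.
  apply: pnormB_lt_of_angle => //; move: h.
  by rewrite -mulrBl normrM normfV [`|pi / 3|]gtr0_norm// ltr_pdivrMr// mul1r.
move=> r rV; have [_ t2 _] := tP r.
rewrite truncn_lt_nat// ltr_pdivrMr//; lra.
Qed.

Lemma exists_minimum V : V != [::] ->
  exists2 m, m \in V & forall r, r \in V -> m <= r.
Proof.
elim: V => // r V IH _; have [->|/IH[m mV mP]] := eqVneq V [::].
  by exists r; rewrite ?mem_head// => r'; rewrite mem_seq1 => /eqP ->.
have [rm|mr] := leP r m.
  exists r; first exact: mem_head.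
  by move=> r'; rewrite inE => /orP[/eqP ->//|/mP]; exact: le_trans.
exists m; first by rewrite inE mV orbT.
by move=> r'; rewrite inE => /orP[/eqP ->|/mP//]; exact: ltW.
Qed.

Lemma exists_maximum V : V != [::] ->
  exists2 m, m \in V & forall r, r \in V -> r <= m.
Proof.
move=> V0; have [|m] := @exists_minimum (map -%R V); first by case: V V0.
case/mapP=> r rV -> mP; exists r => // r' r'V.
by rewrite -lerN2; apply: mP; exact: map_f.
Qed.

(** With [m] the least element, the numbers [a r / (m * c)] lie in [[0, S / c]] and are at least 1
    apart, so their integer parts are distinct. The upper bound comes from [a r <= a m <= m * S]. *)
Lemma size_chain V (a : R -> R) (c S : R) : uniq V -> 0 < c -> 0 <= S ->
  (forall r, r \in V -> 0 < r /\ 0 <= a r <= r * S) ->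
  (forall r r', r \in V -> r' \in V -> r < r' -> a r' + r * c <= a r) ->
  (size V <= (Num.truncn (S / c)).+1)%N.
Proof.
move=> uV c0 S0 aV adec; have [->//|V0] := eqVneq V [::].
have [m mV mP] := exists_minimum V0.
have [m0 /andP[_ amS]] := aV _ mV.
have mc : 0 < m * c by rewrite mulr_gt0.
have age r : r \in V -> 0 <= a r / (m * c).
  by move=> /aV[_ /andP[ar _]]; rewrite divr_ge0// ltW.
have gap r r' : r \in V -> r' \in V -> r < r' ->
    Num.truncn (a r / (m * c)) != Num.truncn (a r' / (m * c)).
  move=> rV r'V rr'; apply/eqP => /truncn_eq_lt1 -/(_ (age _ rV) (age _ r'V)).
  apply/negP; rewrite -leNgt -mulrBl; apply: le_trans (ler_norm _).
  rewrite ler_pdivlMr// mul1r; have := adec _ _ rV r'V rr'.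
  have := ler_wpM2r (ltW c0) (mP _ rV).
  lra.
apply: (@size_le_of_inj _ (fun r => Num.truncn (a r / (m * c)))) => //.
  move=> r r' rV r'V e; have [/gap|/gap|//] := ltgtP r r'.
    by move=> /(_ rV r'V); rewrite e eqxx.
  by move=> /(_ r'V rV); rewrite e eqxx.
move=> r rV; rewrite ltnS le_truncn// ler_pdivrMr//.
have -> : S / c * (m * c) = m * S by field; rewrite gt_eqF.
have [mr|mr|<-//] := ltgtP m r; last by move: mr; rewrite ltNge mP.
have := adec _ _ mV rV mr; lra.
Qed.

(** A duplicate-free list of maximal length in [P] must exhaust [P], as any missing element could be
    prepended. *)
Lemma exists_enumeration (P : set R) n :
  (forall V, uniq V -> (forall r, r \in V -> P r) -> (size V <= n)%N) ->
  exists2 V, (forall r, P r -> r \in V) & uniq V /\ (forall r, r \in V -> P r).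
Proof.
move=> Pn.
pose Q k := `[< exists V, [/\ uniq V, forall r, r \in V -> P r & size V = k] >].
have Q0 : exists k, Q k by exists 0%N; apply/asboolP; exists [::].
have Qn k : Q k -> (k <= n)%N by move=> /asboolP[V [uV VP <-]]; exact: Pn.
case: (ex_maxnP Q0 Qn) => k /asboolP[V [uV VP Vk]] kmax.
exists V => // r Pr; apply/negPn/negP => rV.
have /kmax : Q k.+1.
  apply/asboolP; exists (r :: V); split => /=; rewrite ?rV ?Vk//.
  by move=> r'; rewrite inE => /orP[/eqP ->|/VP].
by rewrite ltnn.
Qed.

End Counting.

Section Values.
Variables (R : realType) (L : R -> R * R -> Prop) (C : R * R -> Prop).

(** The lattice is abstracted to a relation between heights and planar parts, so that it can be
    replaced by its reflection in the heights. *)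
Definition is_value (r : R) : Prop := exists2 t, 0 < t < 1 &
  (exists u x, [/\ L u x, - t < u < 1 - t, C x & pnorm x = r]) /\
  (forall u x, L u x -> - t < u < 1 - t -> C x -> r <= pnorm x).

End Values.

(** * Values below [rho], given a window of heights without short vectors in the cone *)

Section LatticeGeometry.
Variables (R : realType) (cl : bool) (alpha tau : R).
Hypotheses (pi_lt_tau : pi < tau) (tau_lt_2pi : tau < 2 * pi).
Variable L : R -> R * R -> Prop.
Hypothesis LB : forall u x v y, L u x -> L v y -> L (u - v) (x - y).

Local Notation C := (cone cl alpha tau).
Local Notation gamma := (alpha + tau - pi).
Local Notation beta := (2 * pi - tau).

Lemma L_opp u x : L u x -> L (- u) (- x).
Proof. by move=> Lx; have := LB (LB Lx Lx) Lx; rewrite !subrr !sub0r. Qed.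

Variables s rho : R.
Hypotheses (s_ge : 1 / 2 <= s) (s_lt1 : s < 1).
Hypothesis L_empty :
  forall u x, L u x -> - s < u < 1 - s -> C x -> rho <= pnorm x.

(* The lattice vector [(h, x)] attains the value [r], after reversing its sign
   when its height is negative (the second alternative). *)
Definition represents (r h : R) (x : R * R) : Prop :=
  [/\ L h x, pnorm x = r, 1 - s <= h < 1 &
    (C x /\ forall u y, L u y -> 0 <= u <= h -> C y -> r <= pnorm y) \/
    (C (- x) /\ s <= h)].

(** By [L_empty] the height of an attaining vector is at least [1 - s] or at most [- s]. In the
    first case heights from 0 to [h] stay in the window of the same [t], whence the minimality
    clause; in the second the vector is reversed, and [s >= 1 - s]. *)
Lemma exists_representative r : is_value L C r -> r < rho ->
  exists h x, represents r h x.
Proof.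
have s1 := s_ge; have s2 := s_lt1.
move=> [t tI [[u [x [Lx uI Cx xr]]] rP]] rrho.
have [us|su] := ltP u (1 - s); last first.
  exists u, x; split => //; first by apply/andP; split; lra.
  left; split => // v y Ly vI Cy; apply: rP Ly _ Cy; apply/andP; split; lra.
have us' : u <= - s.
  rewrite leNgt; apply/negP => su; have := L_empty Lx; rewrite su us xr => /(_ isT Cx).
  lra.
exists (- u), (- x); split; [exact: L_opp|by rewrite pnormN| |right].
  apply/andP; split; lra.
by rewrite opprK; split=> //; lra.
Qed.

Lemma represents_gt0 r h x : represents r h x -> 0 < r.
Proof.
case=> _ xr _ [[/cone_pnorm_gt0]|[/cone_pnorm_gt0]]; rewrite ?pnormN xr //.
Qed.

Lemma neq0_of_pnorm (x : R * R) : 0 < pnorm x -> x != 0.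
Proof.
apply: contraTN => /eqP ->; rewrite -leNgt.
by rewrite /pnorm /= expr0n addr0 sqrtr0.
Qed.

(* Forces the angle between [x] and [y - x] to exceed [2 pi / 3]: otherwise
   [y = x + (y - x)] would be at least as long as the shorter of the two. *)
Definition exceptional (x y : R * R) : Prop :=
  [/\ ~ C (- x), ~ C (- (y - x)), pnorm y < pnorm x & pnorm y <= pnorm (y - x)].

Lemma far_or_exceptional_le r h x r' h' x' :
  represents r h x -> represents r' h' x' -> r < rho -> r' < rho -> r != r' ->
  h <= h' -> rho <= pnorm (x - x') \/ exceptional x x'.
Proof.
have s1 := s_ge; have s2 := s_lt1.
move=> X X' rrho r'rho rr' hh'.
have r0 := represents_gt0 X; have r'0 := represents_gt0 X'.
case: X => Lx xr hI X; case: X' => Lx' xr' hI' X'.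
have xx' : x - x' != 0.
  by rewrite subr_eq0; apply: contra rr' => /eqP xx'; rewrite -xr -xr' xx'.
have [Cd|nCd] := pselect (C (x - x')).
  by left; apply: (L_empty (LB Lx Lx')) => //; apply/andP; split; lra.
have Ce : C (x' - x) by rewrite -opprB; apply: cone_or_coneN.
have Le := LB Lx' Lx.
have [hlt|hge] := ltP (h' - h) (1 - s).
  left; rewrite pnormB; apply: (L_empty Le) => //; apply/andP; split; lra.
right.
(* Since [h' < 1], now [h < s], so [- x] has its height in the empty window. *)
have nCx : ~ C (- x).
  move=> Cx; have := L_empty (L_opp Lx) _ Cx; rewrite pnormN xr => H.
  have : rho <= r by apply: H; apply/andP; split; lra.
  lra.
have nCe : ~ C (- (x' - x)) by rewrite opprB.
case: X => [[Cx _]|[_ sh]]; last lra.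
(* The reversed case is impossible: [- x'] is the sum of [- x] and [- (x' - x)], both outside the
   cone. *)
case: X' => [[Cx' rec]|[Cx' _]]; last first.
  by have := notconeD pi_lt_tau tau_lt_2pi nCx nCe; rewrite -opprD addrC subrK.
split => //; rewrite ?xr ?xr'.
  (* Both [x] and [x' - x] have heights between 0 and [h'], so the minimality of [r'] applies to
     each. *)
  have : r' <= r by rewrite -xr; apply: (rec _ _ Lx _ Cx); apply/andP; split; lra.
  by rewrite le_eqVlt eq_sym (negPf rr').
by apply: (rec _ _ Le _ Ce); apply/andP; split; lra.
Qed.

(** Ordering by norm replaces ordering by height: if [h' < h], an exceptional pair would have to be
    [x'], [x], contradicting [r' < r]. *)
Lemma far_or_exceptional r h x r' h' x' :
  represents r h x -> represents r' h' x' -> r < rho -> r' < r ->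
  rho <= pnorm (x - x') \/ exceptional x x'.
Proof.
move=> X X' rrho r'r.
have rr' : r != r' by rewrite gt_eqF.
have r'rho : r' < rho by apply: lt_trans rrho.
have [hh'|/ltW h'h] := leP h h'; first exact: far_or_exceptional_le X X' _ _ _ _.
rewrite eq_sym in rr'.
have [|[_ _]] := far_or_exceptional_le X' X r'rho rrho rr' h'h.
  by rewrite pnormB; left.
by case: X => _ -> _ _; case: X' => _ -> _ _ rr; lra.
Qed.

Lemma exceptional_angle x y t : 0 < pnorm y -> exceptional x y ->
  x = polar (pnorm x) (gamma + t) ->
  exists u, [/\ 0 <= u <= beta, 2 * pi / 3 < `|t - u| &
    y - x = polar (pnorm (y - x)) (gamma + u)].
Proof.
move=> y0 [nCx nCe yx ye] xt.
have x0 : 0 < pnorm x by lra.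
have e0 : 0 < pnorm (y - x) by lra.
have [u uI eu] := notconeN_polar pi_lt_tau tau_lt_2pi (neq0_of_pnorm e0) nCe.
exists u; split => //.
rewrite ltNge; apply/negP => /cos_ge_neghalf.
have -> : t - u = (gamma + t) - (gamma + u) by ring.
apply/negP; rewrite -ltNge.
by apply: (cos_lt_of_pnormD x0 e0 _ yx ye); rewrite -xt -eu addrC subrK.
Qed.

(** The two zones collect the angles [t] from which some angle in [[0, beta]] is more than
    [2 * pi / 3] away, on the larger or on the smaller side; note
    [beta - 2 * pi / 3 = 4 * pi / 3 - tau]. *)
Definition right_zone (x : R * R) : Prop := exists2 t,
  0 <= t < beta - 2 * pi / 3 & x = polar (pnorm x) (gamma + t).
Definition left_zone (x : R * R) : Prop := exists2 t,
  2 * pi / 3 < t <= beta & x = polar (pnorm x) (gamma + t).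

Lemma exceptional_zone x y : 0 < pnorm y -> exceptional x y ->
  right_zone x \/ left_zone x.
Proof.
move=> y0 ex; have [nCx _ yx _] := ex.
have x0 : 0 < pnorm x by lra.
have [t tI xt] := notconeN_polar pi_lt_tau tau_lt_2pi (neq0_of_pnorm x0) nCx.
have [u [uI tu _]] := exceptional_angle y0 ex xt.
have [ut|tu'] := leP u t.
  by right; exists t => //; move: tu; rewrite ger0_norm; lra.
by left; exists t => //; move: tu; rewrite ltr0_norm; lra.
Qed.

(** The reflected angle [pi - u] lies in [[tau - pi, pi / 3]], where the sine increases. *)
Lemma sin_beta u : 2 * pi / 3 <= u <= beta -> sin (tau - pi) <= sin u.
Proof.
move=> uI; have t1 := pi_lt_tau; have t2 := tau_lt_2pi; have pi0 := pi_gt0 R.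
by rewrite -(sin_pi_sub u); apply: sin_le_pihalf; lra.
Qed.

(** The right side is the sine of [5 pi / 6 - tau / 2], and [4 pi / 3 - tau < 5 pi / 6 - tau / 2 <
    pi / 2] because [tau > pi]. *)
Lemma sin_zone t : 0 <= t < beta - 2 * pi / 3 ->
  0 <= sin t <= sin (tau / 2 + pi / 6).
Proof.
move=> tI; have t1 := pi_lt_tau; have t2 := tau_lt_2pi; have pi0 := pi_gt0 R.
apply/andP; split; first by apply: sin_ge0_pi; apply/andP; split; lra.
by rewrite -(sin_pi_sub (tau / 2 + _)); apply: sin_le_pihalf; lra.
Qed.

(** Signed distances to the edge lines of the sector; being linear, they can be evaluated on
    [x' - x]. *)
Let right_height x := cross (polar 1 gamma) x.
Let left_height x := cross x (polar 1 (gamma + beta)).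

Lemma right_heightE r t : right_height (polar r (gamma + t)) = r * sin t.
Proof. by rewrite /right_height cross_polar mul1r; congr (_ * sin _); ring. Qed.

Lemma left_heightE r t : left_height (polar r (gamma + t)) = r * sin (beta - t).
Proof. by rewrite /left_height cross_polar mulr1; congr (_ * sin _); ring. Qed.

Lemma right_zone_height x : right_zone x ->
  0 <= right_height x <= pnorm x * sin (tau / 2 + pi / 6).
Proof.
move=> [t /sin_zone/andP[t0 tS] ->]; rewrite right_heightE pnorm_polar ?pnorm_ge0//.
by rewrite mulr_ge0 ?ler_wpM2l ?pnorm_ge0.
Qed.

Lemma left_zone_height x : left_zone x ->
  0 <= left_height x <= pnorm x * sin (tau / 2 + pi / 6).
Proof.
move=> [t tI ->]; rewrite left_heightE pnorm_polar ?pnorm_ge0//.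
have /sin_zone/andP[t0 tS] : 0 <= beta - t < beta - 2 * pi / 3.
  by apply/andP; split; lra.
by rewrite mulr_ge0 ?ler_wpM2l ?pnorm_ge0.
Qed.

Lemma polar_angle_lt (x y : R * R) t u : 0 < pnorm x < rho -> 0 < pnorm y < rho ->
  x = polar (pnorm x) (gamma + t) -> y = polar (pnorm y) (gamma + u) ->
  `|t - u| < pi / 3 -> pnorm (x - y) < rho.
Proof.
move=> xI yI -> -> tu; apply: pnormB_lt_of_angle => //.
by rewrite (_ : gamma + t - (gamma + u) = t - u)//; ring.
Qed.

(** A zone is narrower than [pi / 3], so the pair is too close to be far and is exceptional. Then
    [x' - x] has norm at least [r'] and, as [t < pi / 3], an angle in [[2 pi / 3, beta]]. *)
Lemma right_zone_gap r h x r' h' x' :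
  represents r h x -> represents r' h' x' -> r < rho -> r' < r ->
  right_zone x -> right_zone x' ->
  right_height x + r' * sin (tau - pi) <= right_height x'.
Proof.
have t1 := pi_lt_tau; have t2 := tau_lt_2pi; have pi0 := pi_gt0 R.
move=> X X' rrho r'r [t tI xt] [t' tI' xt'].
have r0 := represents_gt0 X; have r'0 := represents_gt0 X'.
have xr : pnorm x = r by case: X.
have xr' : pnorm x' = r' by case: X'.
have [|ex] := far_or_exceptional X X' rrho r'r.
  rewrite leNgt (@polar_angle_lt _ _ t t')// ?xr ?xr' ?r0 ?r'0//=; first lra.
  by rewrite ltr_norml; apply/andP; split; lra.
have x'0 : 0 < pnorm x' by rewrite xr'.
have [u [uI tu eu]] := exceptional_angle x'0 ex xt.
have [_ _ _ ye] := ex.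
have {}uI : 2 * pi / 3 <= u <= beta.
  by move: tu; have [ut|tu'] := leP u t; [rewrite ger0_norm|rewrite ltr0_norm]; lra.
have -> : right_height x' = right_height x + right_height (x' - x).
  by rewrite /right_height -crossDr [x + _]addrC subrK.
rewrite lerD2l eu right_heightE.
apply: ler_pM; rewrite -?xr' ?pnorm_ge0//; last exact: sin_beta.
by apply: sin_ge0_pi; apply/andP; split; lra.
Qed.

(** Mirror image of the previous case: [x' - x] now has its angle in [[0, beta - 2 pi / 3]], hence
    at least [2 pi / 3] from the left edge. *)
Lemma left_zone_gap r h x r' h' x' :
  represents r h x -> represents r' h' x' -> r < rho -> r' < r ->
  left_zone x -> left_zone x' ->
  left_height x + r' * sin (tau - pi) <= left_height x'.
Proof.
have t1 := pi_lt_tau; have t2 := tau_lt_2pi; have pi0 := pi_gt0 R.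
move=> X X' rrho r'r [t tI xt] [t' tI' xt'].
have r0 := represents_gt0 X; have r'0 := represents_gt0 X'.
have xr : pnorm x = r by case: X.
have xr' : pnorm x' = r' by case: X'.
have [|ex] := far_or_exceptional X X' rrho r'r.
  rewrite leNgt (@polar_angle_lt _ _ t t')// ?xr ?xr' ?r0 ?r'0//=; first lra.
  by rewrite ltr_norml; apply/andP; split; lra.
have x'0 : 0 < pnorm x' by rewrite xr'.
have [u [uI tu eu]] := exceptional_angle x'0 ex xt.
have [_ _ _ ye] := ex.
have {}uI : 0 <= u <= beta - 2 * pi / 3.
  by move: tu; have [ut|tu'] := leP u t; [rewrite ger0_norm|rewrite ltr0_norm]; lra.
have -> : left_height x' = left_height x + left_height (x' - x).
  by rewrite /left_height -crossDl [x + _]addrC subrK.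
rewrite lerD2l eu left_heightE.
apply: ler_pM; rewrite -?xr' ?pnorm_ge0//; last first.
  by apply: sin_beta; apply/andP; split; lra.
by apply: sin_ge0_pi; apply/andP; split; lra.
Qed.

Lemma size_values_lt (V : seq R) : uniq V ->
  (forall r, r \in V -> is_value L C r /\ r < rho) ->
  (size V <= if (4 * pi / 3 <= tau)%R then 6
             else 6 + 2 * (Num.truncn (sin (tau / 2 + pi / 6) / sin (tau - pi))).+1)%N.
Proof.
move=> uV Vval; have t1 := pi_lt_tau; have t2 := tau_lt_2pi; have pi0 := pi_gt0 R.
have /choice[w wP] : forall r, exists w : R * (R * R),
    r \in V -> represents r w.1 w.2.
  move=> r; case: (boolP (r \in V)) => [/Vval[rv rrho]|_]; last by exists 0.
  by have [h [x X]] := exists_representative rv rrho; exists (h, x).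
have Vw r : r \in V ->
    [/\ represents r (w r).1 (w r).2, 0 < r, r < rho & pnorm (w r).2 = r].
  move=> rV; have X := wP _ rV; split=> //; first exact: represents_gt0 X.
    by have [] := Vval _ rV.
  by case: X.
pose x r := (w r).2.
pose rz r := `[< right_zone (x r) >]; pose lz r := `[< left_zone (x r) >].
(* An exceptional pair has its longer member in a zone, so outside the zones all pairs are
   [rho]-separated. *)
have far : (size [seq r <- V | ~~ (rz r || lz r)] <= 6)%N.
  apply: (@size_separated _ _ x rho); first exact: filter_uniq.
    by move=> r; rewrite mem_filter => /andP[_ /Vw[_ -> -> ->]].
  move=> r r'; rewrite !mem_filter => /andP[nz rV] /andP[nz' r'V].
  have [X r0 rrho xr] := Vw _ rV; have [X' r'0 r'rho xr'] := Vw _ r'V.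
  have aux a b : exceptional (x a) (x b) -> 0 < pnorm (x b) -> rz a || lz a.
    move=> ex b0; apply/orP; case: (exceptional_zone b0 ex) => z; [left|right];
    exact/asboolP.
  rewrite -/(x r) in xr; rewrite -/(x r') in xr'.
  rewrite neq_lt => /orP[rr'|r'r].
    have [|ex] := far_or_exceptional X' X r'rho rr'; first by rewrite pnormB.
    by move: nz'; rewrite (aux r' r)// xr.
  have [//|ex] := far_or_exceptional X X' rrho r'r.
  by move: nz; rewrite (aux r r')// xr'.
have Vsize : (size V <= size [seq r <- V | ~~ (rz r || lz r)] +
    (size [seq r <- V | rz r] + size [seq r <- V | lz r]))%N.
  rewrite !size_filter -(count_predC (fun r => rz r || lz r) V) addnC leq_add2l.
  by rewrite -count_predUI leq_addr.
case: ifPn => [tau_ge|]; [|rewrite -ltNge => tau_lt].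
  (* Here [beta <= 2 * pi / 3], which empties both zones. *)
  have rz0 r : rz r = false.
    by apply/asboolP => -[t tI _]; lra.
  have lz0 r : lz r = false.
    by apply/asboolP => -[t tI _]; lra.
  apply: leq_trans Vsize _.
  by rewrite (eq_filter rz0) (eq_filter lz0) filter_pred0 addn0.
have c0 : 0 < sin (tau - pi) by apply: sin_gt0_pi; apply/andP; split; lra.
have S0 : 0 <= sin (tau / 2 + pi / 6) by apply: sin_ge0_pi; apply/andP; split; lra.
apply: leq_trans Vsize _; rewrite mul2n -addnn leq_add// leq_add//.
  apply: (@size_chain _ _ (right_height \o x)) => //; first exact: filter_uniq.
    move=> r; rewrite mem_filter => /andP[/asboolP z /Vw[_ r0 _ xr]]; split=> //.
    by have := right_zone_height z; rewrite xr.
  move=> r r'; rewrite !mem_filter => /andP[/asboolP z rV] /andP[/asboolP z' r'V] rr'.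
  have [X _ _ _] := Vw _ rV; have [X' _ r'rho _] := Vw _ r'V.
  exact: right_zone_gap X' X r'rho rr' z' z.
apply: (@size_chain _ _ (left_height \o x)) => //; first exact: filter_uniq.
  move=> r; rewrite mem_filter => /andP[/asboolP z /Vw[_ r0 _ xr]]; split=> //.
  by have := left_zone_height z; rewrite xr.
move=> r r'; rewrite !mem_filter => /andP[/asboolP z rV] /andP[/asboolP z' r'V] rr'.
have [X _ _ _] := Vw _ rV; have [X' _ r'rho _] := Vw _ r'V.
exact: left_zone_gap X' X r'rho rr' z' z.
Qed.

End LatticeGeometry.

(** * All values, for either position of the parameter attaining the largest one *)

Section AllValues.
Variables (R : realType) (cl : bool) (alpha tau : R).
Hypotheses (pi_lt_tau : pi < tau) (tau_lt_2pi : tau < 2 * pi).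
Local Notation C := (cone cl alpha tau).

(** Negating heights exchanges the windows of [t] and [1 - t]. *)
Lemma is_value_reflect (L : R -> R * R -> Prop) r :
  is_value L C r -> is_value (fun u x => L (- u) x) C r.
Proof.
move=> [t tI [[u [x [Lx uI Cx xr]]] rP]].
exists (1 - t); first by apply/andP; split; lra.
split; first by exists (- u), x; rewrite opprK; split=> //; apply/andP; split; lra.
by move=> v y Ly vI; apply: rP Ly _; apply/andP; split; lra.
Qed.

Lemma size_values (L : R -> R * R -> Prop) (V : seq R) :
  (forall u x v y, L u x -> L v y -> L (u - v) (x - y)) ->
  uniq V -> (forall r, r \in V -> is_value L C r) ->
  (size V <= if (4 * pi / 3 <= tau)%R then 7
    else 7 + 2 * (Num.truncn (sin (tau / 2 + pi / 6) / sin (tau - pi))).+1)%N.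
Proof.
move=> LB uV Vval; have [->//|V0] := eqVneq V [::].
have [rho rhoV rhoP] := exists_maximum V0.
have Vlt r : r \in rem rho V -> is_value L C r /\ r < rho.
  rewrite mem_rem_uniq// inE => /andP[rrho rV]; split; first exact: Vval.
  by rewrite lt_neqAle rrho rhoP.
have uV' : uniq (rem rho V) by rewrite rem_uniq.
(* The largest value [rho] accounts for the step from 6 to 7; minimality at its parameter [s] is the
   emptiness hypothesis. *)
suff : (size (rem rho V) <= if (4 * pi / 3 <= tau)%R then 6
    else 6 + 2 * (Num.truncn (sin (tau / 2 + pi / 6) / sin (tau - pi))).+1)%N.
  by rewrite size_rem//; case: ifP => _ /=; lia.
have [s /andP[s0 s1] [_ sP]] := Vval _ rhoV.
have [s2|s2] := leP (1 / 2) s.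
  exact: (size_values_lt pi_lt_tau tau_lt_2pi LB s2 s1 sP).
apply: (@size_values_lt _ cl alpha tau pi_lt_tau tau_lt_2pi
  (fun u x => L (- u) x) _ (1 - s) rho) => //; [|lra|lra| |].
- by move=> u x v y Lx Ly; rewrite opprD; apply: LB.
- move=> u x Lx uI; apply: sP Lx _; apply/andP; split; lra.
by move=> r /Vlt[/is_value_reflect].
Qed.

End AllValues.

(** * Comparison with the stated bound, and conclusion *)

Lemma bound41_ge (R : realType) (tau : R) (n : nat) : pi < tau < 2 * pi ->
  (n <= if (4 * pi / 3 <= tau)%R then 7
    else 7 + 2 * (Num.truncn (sin (tau / 2 + pi / 6) / sin (tau - pi))).+1)%N ->
  n%:Z <= bound41 tau.
Proof.
move=> /andP[t1 t2]; have pi0 := pi_gt0 R; rewrite /bound41.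
(* The count 7 is compared with 8 or 9 for [tau >= 4 * pi / 3], and [9 + 2 k] with [12 + 2 k] below,
   [k] being the integer part of the quotient. *)
case: ifPn => tau_ge nle.
  case: ifP => _; first by lia.
  case: ifP => _; first by lia.
  case: ifPn => [_|/negbTE t4]; first by lia.
  have -> : tau == 4 * pi / 3 by rewrite eq_le tau_ge leNgt t4.
  by lia.
rewrite -ltNge in tau_ge.
rewrite ifF; last by apply/negbTE; rewrite -leNgt; lra.
rewrite ifF; last by apply/eqP => te; lra.
rewrite ifF; last by apply/negbTE; rewrite -leNgt; lra.
rewrite ifF; last by apply/eqP => te; lra.
set q := sin _ / sin _ in nle *.
have q0 : 0 <= q.
  by apply: divr_ge0; apply: sin_ge0_pi; apply/andP; split; lra.
have : (Num.truncn q)%:Z <= Num.floor q.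
  by rewrite floor_ge_int; move: (truncn_le q); rewrite q0.
by lia.
Qed.

Theorem theorem4p1 (R : realType) (M : 'M[R]_3) (cl : bool) (alpha tau : R) :
  \det M = 1 ->
  pi < tau < 2%:R * pi ->
  exists s : seq R,
    (forall r, Fvalues M (halfopen_arc cl alpha tau) r -> r \in s) /\
    ((size s)%:Z <= bound41 tau)%R.
Proof.
move=> _ tauI; have /andP[t1 t2] := tauI.
pose vec (v : 'rV[R]_3) := (v ord0 (inord 1), v ord0 (inord 2)).
pose L u x := exists m,
  u = lattice_pt M m ord0 ord0 /\ x = vec (lattice_pt M m).
have LB u x v y : L u x -> L v y -> L (u - v) (x - y).
  move=> [m [-> ->]] [k [-> ->]]; exists (m - k).
  have -> : lattice_pt M (m - k) = lattice_pt M m - lattice_pt M k.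
    by rewrite /lattice_pt map_mxB mulmxBl.
  by rewrite /vec !mxE.
have val r : Fvalues M (halfopen_arc cl alpha tau) r ->
    is_value L (cone cl alpha tau) r.
  move=> [t [tI [[v [[[m vm] [vI vC]] vr]] rP]]]; exists t => //.
  split; first by exists (v ord0 ord0), (vec v); split => //; exists m; rewrite -vm.
  by move=> u x [k [-> ->]] uI xC; apply: rP; split => //; exists k.
have Vsize V (uV : uniq V)
    (VP : forall r, r \in V -> Fvalues M (halfopen_arc cl alpha tau) r) :=
  size_values t1 t2 LB uV (fun r rV => val r (VP r rV)).
(* The uniform bound on lists of values makes their set finite, and then applies to its
   enumeration. *)
have [V VF [uV VP]] := exists_enumeration Vsize.
exists V; split => //.
apply: bound41_ge tauI _; exact: Vsize.
Qed.
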